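(* Let $\widetilde G=A\times G$ be a definable extension of a definable group $G$ by a definable abelian group $A$, with the corresponding short exact sequence $0\to A\to\widetilde G\overset{\pi}{\to}G\to 0$. Suppose $\widetilde H\unlhd\widetilde G$ is an invariant normal subgroup of bounded index, generated by a countable family of type-definable sets, and contained in a type-definable group $\overline H\le\widetilde G$. Put $A_H:=\overline H\cap A$ and $H:=\pi[\overline H]$. Assume that $H=\pi[\widetilde H]$, that $H$ acts trivially on $A_H/(\widetilde H\cap A)$, and that $\widetilde H\cap A$ is type-definable. Then $\widetilde H$ is type-definable.
   Context: Conventions: we work in a monster model $\mathfrak C$ of a complete theory with infinite models (language of arbitrary cardinality): $\mathfrak C$ is $\kappa$-saturated and strongly $\kappa$-homogeneous for a sufficiently large cardinal $\kappa$. ''Small'' and ''bounded'' mean of cardinality $<\kappa$. ''Definable'', ''type-definable'', ''invariant'' mean without parameters (over $\emptyset$). Definable extension: let $G$ be a definable group with a definable action on a definable abelian group $A$ by automorphisms, and let $h\colon G^2\to A$ be a definable 2-cocycle, i.e. for all $g,g_1,g_2,g_3\in G$: $h(g_1,g_2)+h(g_1g_2,g_3)=h(g_1,g_2g_3)+g_1\cdot h(g_2,g_3)$ and $h(g,e)=h(e,g)=0$. The definable extension of $G$ by $A$ given by these data is the group $\widetilde G=A\times G$ with multiplication $(a_1,g_1)\cdot(a_2,g_2)=(a_1+g_1\cdot a_2+h(g_1,g_2),\,g_1g_2)$. $A$ is identified with the normal subgroup $A\times\{e\}$ of $\widetilde G$, and $\pi\colon\widetilde G\to G$ is the projection $(a,g)\mapsto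 g$. The action of $G$ on $A$ agrees with conjugation in $\widetilde G$, so $H$ acts on $A_H/(\widetilde H\cap A)$. *)

(* Defs.v *)
From HB Require Import structures.
From mathcomp Require Import all_boot ssralg.
From mathcomp Require Import boolp classical_sets functions cardinality.

Set Implicit Arguments.
Unset Strict Implicit.
Unset Printing Implicit Defensive.

Import GRing.Theory.

Local Open Scope classical_set_scope.
Local Open Scope card_scope.

Record language := Language {
  fsym : Type;
  fun_arity : fsym -> nat;
  rsym : Type;
  rel_arity : rsym -> nat }.

(* [V] is the set of variables that may occur; [C^V] is the function type
   [V -> C]. *)
Inductive term (L : language) (V : Type) : Type :=
| Var of V
| App (f : fsym L) of ('I_(fun_arity f) -> term L V).

(* [formula L V] consists of the formulas whose free variables are among [V].
   The bound variable of [All] is [None : option V]. *)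
Inductive formula (L : language) (V : Type) : Type :=
| Bot
| Eq of term L V & term L V
| Rel (r : rsym L) of ('I_(rel_arity r) -> term L V)
| Imp of formula L V & formula L V
| All of formula L (option V).

Record structure (L : language) := Structure {
  carrier :> Type;
  fun_interp : forall f : fsym L, ('I_(fun_arity f) -> carrier) -> carrier;
  rel_interp : forall r : rsym L, ('I_(rel_arity r) -> carrier) -> Prop }.

Fixpoint eval (L : language) (C : structure L) (V : Type) (x : V -> C)
    (t : term L V) : C :=
  match t with
  | Var v => x v
  | App f ts => fun_interp (fun i => eval x (ts i))
  end.

Definition extend (C V : Type) (x : V -> C) (c : C) (o : option V) : C :=
  if o is Some v then x v else c.

Fixpoint sat (L : language) (C : structure L) (V : Type) (phi : formula L V) :
    (V -> C) -> Prop :=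
  match phi with
  | Bot => fun=> False
  | Eq t u => fun x => eval x t = eval x u
  | Rel r ts => fun x => rel_interp (fun i => eval x (ts i))
  | Imp phi psi => fun x => sat phi x -> sat psi x
  | All phi => fun x => forall c : C, sat phi (extend x c)
  end.

Definition join (C V W : Type) (x : V -> C) (y : W -> C) (i : V + W) : C :=
  match i with inl v => x v | inr w => y w end.

Definition definable (L : language) (C : structure L) (V : Type)
    (S : set (V -> C)) : Prop :=
  exists phi : formula L V, S = [set x | sat phi x].

Definition type_definable (L : language) (C : structure L) (V : Type)
    (S : set (V -> C)) : Prop :=
  exists p : set (formula L V), S = [set x | forall phi, p phi -> sat phi x].

Definition automorphism (L : language) (C : structure L) (s : C -> C) : Prop :=
  [/\ bijective s,
      forall (f : fsym L) (x : 'I_(fun_arity f) -> C),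
        s (fun_interp x) = fun_interp (s \o x) &
      forall (r : rsym L) (x : 'I_(rel_arity r) -> C),
        rel_interp (s \o x) <-> rel_interp x].

Definition aut_invariant (L : language) (C : structure L) (V : Type)
    (S : set (V -> C)) : Prop :=
  forall s : C -> C, automorphism s -> forall x, S x -> S (s \o x).

(* The cardinal [kappa] is given by a type of that cardinality. *)
Definition smaller (kappa T : Type) (S : set T) : Prop :=
  S #<= [set: kappa] /\ ~ ([set: kappa] #<= S).

(* A formula with parameters in [B] has its variables in ['I_n + B], those in
   [B] being evaluated to themselves. *)
Definition saturated (kappa : Type) (L : language) (C : structure L) : Prop :=
  forall (B : set C) (n : nat) (p : set (formula L ('I_n + B))),
    smaller kappa B ->
    (forall q, q `<=` p -> finite_set q ->
       exists x : 'I_n -> C, forall phi, q phi -> sat phi (join x val)) ->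
    exists x : 'I_n -> C, forall phi, p phi -> sat phi (join x val).

Definition partial_elementary (L : language) (C : structure L) (B : set C)
    (f : B -> C) : Prop :=
  forall phi : formula L B, sat phi f <-> sat phi (val : B -> C).

Definition strongly_homogeneous (kappa : Type) (L : language)
    (C : structure L) : Prop :=
  forall (B : set C) (f : B -> C),
    smaller kappa B -> partial_elementary f ->
    exists2 s : C -> C, automorphism s & forall b : B, s (val b) = f b.

(* [formula L nat] has cardinality |L| + aleph_0, so [monster_large] reads
   kappa > |L| + aleph_0. *)
Record monster_model (kappa : Type) (L : language) (C : structure L) : Prop := {
  monster_infinite : infinite_set [set: C];
  monster_large : smaller kappa [set: formula L nat];
  monster_saturated : saturated kappa C;
  monster_homogeneous : strongly_homogeneous kappa C }.

Record def_set (L : language) (C : structure L) := DefSet {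
  set_dim : nat;
  dom : set ('I_set_dim -> C);
  dom_definable : definable dom }.
Arguments dom [L C].

Definition def_set_sort (L : language) (C : structure L) (X : def_set C) :
  Type := dom X.
Coercion def_set_sort : def_set >-> Sortclass.

Definition coord (L : language) (C : structure L) (X : def_set C) (x : X) :
  'I_(set_dim X) -> C := val x.
Arguments coord [L C] X.

Definition coord2 (L : language) (C : structure L) (X Y : def_set C)
    (z : X * Y) : 'I_(set_dim X) + 'I_(set_dim Y) -> C :=
  join (coord X z.1) (coord Y z.2).

Definition definable_map2 (L : language) (C : structure L) (X Y Z : def_set C)
    (f : X -> Y -> Z) : Prop :=
  definable [set join (coord2 (x, y)) (coord Z (f x y))
            | x in [set: X] & y in [set: Y]].

(* Definability of the unit and of the inverse follows from that of the
   multiplication. *)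
Record def_group (L : language) (C : structure L) := DefGroup {
  gset : def_set C;
  gmul : gset -> gset -> gset;
  gone : gset;
  ginv : gset -> gset;
  gmulA : associative gmul;
  gmul1 : left_id gone gmul;
  gmulV : left_inverse gone ginv gmul;
  gmul_definable : definable_map2 gmul }.

Record def_abgroup (L : language) (C : structure L) := DefAbGroup {
  aset : def_set C;
  aadd : aset -> aset -> aset;
  azero : aset;
  aopp : aset -> aset;
  aaddA : associative aadd;
  aaddC : commutative aadd;
  aadd0 : left_id azero aadd;
  aaddN : left_inverse azero aopp aadd;
  aadd_definable : definable_map2 aadd }.

Definition def_group_sort (L : language) (C : structure L) (G : def_group C) :
  Type := gset G.
Coercion def_group_sort : def_group >-> Sortclass.

Definition def_abgroup_sort (L : language) (C : structure L)
  (A : def_abgroup C) : Type := aset A.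
Coercion def_abgroup_sort : def_abgroup >-> Sortclass.

Section DefGroupInstances.
Variables (L : language) (C : structure L) (G : def_group C)
  (A : def_abgroup C).

Lemma gmulr1 : right_id (gone G) (@gmul L C G).
Proof.
have mulV (x : gset G) : gmul x (ginv x) = gone G.
  rewrite -[LHS]gmul1 -{1}(gmulV (ginv x)) -gmulA [gmul (ginv x) _]gmulA gmulV.
  by rewrite gmul1 gmulV.
by move=> x; rewrite -(gmulV x) gmulA mulV gmul1.
Qed.

Lemma gmulrV : right_inverse (gone G) (@ginv L C G) (@gmul L C G).
Proof.
move=> x; rewrite -[LHS]gmul1 -{1}(gmulV (ginv x)) -gmulA.
by rewrite [gmul (ginv x) _]gmulA gmulV gmul1 gmulV.
Qed.

HB.instance Definition _ := gen_eqMixin (def_group_sort G).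
HB.instance Definition _ := gen_choiceMixin (def_group_sort G).
HB.instance Definition _ := isGroup.Build (def_group_sort G)
  (@gmulA L C G) (@gmul1 L C G) gmulr1 (@gmulV L C G) gmulrV.

HB.instance Definition _ := gen_eqMixin (def_abgroup_sort A).
HB.instance Definition _ := gen_choiceMixin (def_abgroup_sort A).
HB.instance Definition _ := GRing.isZmodule.Build (def_abgroup_sort A)
  (@aaddA L C A) (@aaddC L C A) (@aadd0 L C A) (@aaddN L C A).
End DefGroupInstances.

(* Each [act g] is an automorphism of [A], with inverse [act g^-1]. *)
Record def_extension (L : language) (C : structure L) (G : def_group C)
    (A : def_abgroup C) := DefExtension {
  act : G -> A -> A;
  act_one : forall a, act 1%g a = a;
  act_mul : forall g1 g2 a, act (g1 * g2)%g a = act g1 (act g2 a);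
  act_add : forall g a b, act g (a + b)%R = (act g a + act g b)%R;
  act_definable : @definable_map2 L C (gset G) (aset A) (aset A) act;
  cocycle : G -> G -> A;
  cocycleP : forall g1 g2 g3,
    (cocycle g1 g2 + cocycle (g1 * g2)%g g3
     = cocycle g1 (g2 * g3)%g + act g1 (cocycle g2 g3))%R;
  cocycler1 : forall g, cocycle g 1%g = 0%R;
  cocycle1r : forall g, cocycle 1%g g = 0%R;
  cocycle_definable : @definable_map2 L C (gset G) (gset G) (aset A) cocycle }.

Definition ext (L : language) (C : structure L) (G : def_group C)
  (A : def_abgroup C) (E : def_extension G A) : Type := (A * G)%type.

Section Extension.
Variables (L : language) (C : structure L) (G : def_group C)
  (A : def_abgroup C) (E : def_extension G A).

Definition ext_mul (x y : ext E) : ext E :=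
  ((x.1 + act E x.2 y.1 + cocycle E x.2 y.2)%R, (x.2 * y.2)%g).

Definition ext_one : ext E := (0%R, 1%g).

Definition ext_inv (x : ext E) : ext E :=
  ((- act E x.2^-1%g x.1 - cocycle E x.2^-1%g x.2)%R, (x.2^-1)%g).

Lemma act_zero g : act E g 0%R = 0%R.
Proof. by apply: (addrI (act E g 0%R)); rewrite -act_add !addr0. Qed.

Lemma act_opp g a : act E g (- a)%R = (- act E g a)%R.
Proof. by apply: (addrI (act E g a)); rewrite -act_add !subrr act_zero. Qed.

Lemma ext_mulA : associative ext_mul.
Proof.
case=> [a1 g1] [a2 g2] [a3 g3]; rewrite /ext_mul /= mulgA !act_add act_mul.
congr pair; rewrite -!addrA; congr (_ + (_ + _))%R.
by rewrite [RHS]addrCA cocycleP; congr (_ + _)%R; rewrite addrC.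
Qed.

Lemma ext_mul1 : left_id ext_one ext_mul.
Proof.
by case=> [a g]; rewrite /ext_mul /= mul1g act_one cocycle1r add0r addr0.
Qed.

Lemma ext_mulr1 : right_id ext_one ext_mul.
Proof.
by case=> [a g]; rewrite /ext_mul /= mulg1 act_zero cocycler1 !addr0.
Qed.

Lemma ext_mulV : left_inverse ext_one ext_inv ext_mul.
Proof.
case=> [a g]; rewrite /ext_mul /ext_inv /= mulVg; congr pair.
by rewrite addrAC subrK addNr.
Qed.

Lemma ext_mulrV : right_inverse ext_one ext_inv ext_mul.
Proof.
case=> [a g]; rewrite /ext_mul /ext_inv /= mulgV; congr pair.
rewrite act_add !act_opp -act_mul mulgV act_one.
have := cocycleP E g g^-1%g g.
rewrite mulgV mulVg cocycle1r cocycler1 addr0 add0r => ->.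
by rewrite addrA subrr add0r addNr.
Qed.

HB.instance Definition _ := gen_eqMixin (ext E).
HB.instance Definition _ := gen_choiceMixin (ext E).
HB.instance Definition _ := isGroup.Build (ext E)
  ext_mulA ext_mul1 ext_mulr1 ext_mulV ext_mulrV.

Definition ext_in (a : A) : ext E := (a, 1%g).

Definition ext_pi (x : ext E) : G := x.2.

Definition ext_coord : ext E -> 'I_(set_dim (aset A)) + 'I_(set_dim (gset G)) -> C :=
  @coord2 L C (aset A) (gset G).
End Extension.

Arguments ext_in [L C G A] E.
Arguments ext_pi [L C G A] E.
Arguments ext_coord [L C G A] E.

Section Subgroups.
Local Open Scope group_scope.
Variables (G : groupType).

Definition subgroup (S : set G) : Prop :=
  [/\ S 1, forall x y, S x -> S y -> S (x * y) & forall x, S x -> S x^-1].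

Definition normal_subgroup (S : set G) : Prop :=
  subgroup S /\ forall x y, S y -> S (x * y * x^-1).

Definition generated_subgroup (X : set G) : set G := smallest subgroup X.

Definition lcosets (S : set G) : set (set G) :=
  [set [set x * y | y in S] | x in [set: G]].
End Subgroups.

(* Main.v *)
Require Import Defs.
From mathcomp Require Import all_boot ssralg.
From mathcomp Require Import boolp classical_sets functions cardinality.

Set Implicit Arguments.
Unset Strict Implicit.
Unset Printing Implicit Defensive.

Local Open Scope classical_set_scope.

(** Only a covering property of the group [H] has to be shown. Write [Ht] as the
    union of an increasing sequence of type-definable sets [Y n], each
    containing the quotients of elements of the previous one. If some [Y n]
    already projects onto [H], then [Ht] is the product of [Y n] and
    [Ht] intersected with [A]: an element [z] of [Ht] has the same projection as
    some [x] in [Y n], and [x^-1 * z] lies in [Ht] and in [A]. A product of two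
    type-definable sets is type-definable, by compactness.

    That some [Y n] projects onto [H] is a theorem of Newelski: if a
    type-definable group [K] is covered by countably many type-definable sets
    [V n], then finitely many two-sided translates of a single
    [V n * (V n)^-1] cover it ([type_definable_cover]). It is applied to [Hbar]
    and the sets of elements of [Hbar] whose projection is that of an element of
    [Y n]; the translating elements are themselves in one of these sets, so
    their effect is absorbed by a larger [n].

    For Newelski's theorem, call a subset of [K] generic if finitely many
    translates cover [K], and wide if its union with some non-generic set is
    generic. The sets that are not wide form a translation-invariant proper
    ideal. By a Baire category argument ([wide_somewhere]) there are a wide
    definable [D] and an [n] such that every wide definable subset of [D] meets
    [V n]; so, up to a set which is not wide, [D] is contained in each definable
    superset of [V n]. On the other hand finitely many [g] are such that for
    every [h] in [K] some intersection of a translate [g * D] with a translate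
    [h * g' * D] is wide ([wide_translates_meet]). Replacing [D] by the
    definable supersets of [V n] and using compactness, [g * V n] meets
    [h * g' * V n], that is, [h] lies in [g * V n * (V n)^-1 * g'^-1]. *)

(** * Formulas *)

Section Formulas.
Variables (L : language) (C : structure L).

Fixpoint term_rename (V W : Type) (f : V -> W) (t : term L V) : term L W :=
  match t with
  | Var v => Var L (f v)
  | App g ts => App (fun i => term_rename f (ts i))
  end.

(** Renaming of the free variables, by a map that need not be injective. *)
Fixpoint rename (V W : Type) (f : V -> W) (phi : formula L V) : formula L W :=
  match phi with
  | Bot => Bot L W
  | Eq t u => Eq (term_rename f t) (term_rename f u)
  | Rel r ts => Rel (fun i => term_rename f (ts i))
  | Imp phi psi => Imp (rename f phi) (rename f psi)
  | All phi => All (rename (omap f) phi)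
  end.

Lemma eval_rename (V W : Type) (f : V -> W) (x : W -> C) (t : term L V) :
  eval x (term_rename f t) = eval (x \o f) t.
Proof.
by elim: t => //= g ts IH; congr fun_interp; apply/funext => i.
Qed.

Lemma sat_rename (V : Type) (phi : formula L V) (W : Type) (f : V -> W)
  (x : W -> C) : sat (rename f phi) x <-> sat phi (x \o f).
Proof.
elim: phi W f x => [V' //|V' t u|V' r ts|V' phi IH psi IH'|V' phi IH] W f x /=.
- by rewrite !eval_rename.
- suff -> : (fun i => eval x (term_rename f (ts i)))
            = (fun i => eval (x \o f) (ts i)) by [].
  by apply/funext => i; rewrite eval_rename.
- by split=> H1 /IH/H1/IH'.
- have E c : extend x c \o omap f = extend (x \o f) c by apply/funext; case.
  by split=> H c; [rewrite -E; apply/IH | apply/IH; rewrite E].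
Qed.

Definition Neg V (phi : formula L V) := Imp phi (Bot L V).
Definition Ex V (phi : formula L (option V)) := Neg (All (Neg phi)).

Lemma sat_Ex V (phi : formula L (option V)) (x : V -> C) :
  sat (Ex phi) x <-> exists c, sat phi (extend x c).
Proof.
split=> /= [H|[c Hc] /(_ c)//]; apply: contrapT => nex.
by apply: H => c Hc; apply: nex; exists c.
Qed.

Lemma ex_ord_formula n (V : Type) (phi : formula L (V + 'I_n)) :
  exists psi : formula L V,
    forall x : V -> C, sat psi x <-> exists y, sat phi (join x y).
Proof.
elim: n V phi => [|n IH] V phi.
  pose f (i : V + 'I_0) : V :=
    match i with inl v => v | inr i => False_rect V (notF (valP i)) end.
  have fE x y : @join C V 'I_0 x y = x \o f.
    by apply/funext => -[v //|[m H]]; have := H; rewrite ltn0.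
  exists (rename f phi) => x; rewrite sat_rename; split=> [H|[y]].
    by exists (fun i : 'I_0 => False_rect C (notF (valP i))); rewrite fE.
  by rewrite fE.
(* The first of the quantified variables becomes the variable bound by [Ex]. *)
pose f (i : V + 'I_n.+1) : option V + 'I_n :=
  match i with
  | inl v => inl (Some v)
  | inr i => if unlift ord0 i is Some j then inr j else inl None
  end.
have [psi psiP] := IH _ (rename f phi).
exists (Ex psi) => x; rewrite sat_Ex; split=> [[c /psiP[y]]|[y Hy]].
  rewrite sat_rename => H.
  exists (fun i => if unlift ord0 i is Some j then y j else c).
  congr (sat phi _) : H.
  by apply/funext => -[v //|i] /=; case: (unlift ord0 i).
exists (y ord0); apply/psiP; exists (y \o lift ord0).
rewrite sat_rename; congr (sat phi _) : Hy.
by apply/funext => -[v //|i] /=; case: unliftP => [j ->|->].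
Qed.

Lemma ex_formula (V : Type) (W : finType) (phi : formula L (V + W)) :
  exists psi : formula L V,
    forall x : V -> C, sat psi x <-> exists y, sat phi (join x y).
Proof.
pose f (i : V + W) : V + 'I_#|W| :=
  match i with inl v => inl v | inr w => inr (enum_rank w) end.
have [psi psiP] := ex_ord_formula (rename f phi).
exists psi => x; rewrite psiP; split=> -[y Hy].
  exists (y \o enum_rank); move/sat_rename: Hy; congr (sat phi _).
  by apply/funext => -[].
exists (y \o enum_val); apply/sat_rename; congr (sat phi _) : Hy.
by apply/funext => -[v //|w] /=; rewrite enum_rankK.
Qed.

Lemma eq_formula (V : Type) (W : finType) (f g : W -> V) :
  exists psi : formula L V,
    forall x : V -> C, sat psi x <-> forall w, x (f w) = x (g w).
Proof.
suff [psi psiP] : exists psi : formula L V,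
    forall x : V -> C, sat psi x <->
      forall w, w \in enum W -> x (f w) = x (g w).
  exists psi => x; rewrite psiP; split=> H w //; apply: H.
  by rewrite mem_enum.
elim: (enum W) => [|w s [psi psiP]].
  by exists (Neg (Bot L V)) => x; split=> [_ w|_ //]; rewrite in_nil.
exists (Neg (Imp (Eq (Var L (f w)) (Var L (g w))) (Neg psi))) => x /=.
rewrite psiP; split=> [H u|H H'].
  have [Ew Es] : x (f w) = x (g w) /\
                 forall v, v \in s -> x (f v) = x (g v).
    by apply: contrapT => nE; apply: H => Ew Es; apply: nE.
  by rewrite inE => /orP[/eqP->|/Es].
by apply: H' => [|u us]; apply: H; rewrite inE ?eqxx ?us ?orbT.
Qed.

(** Saturation, for parameters and realizations indexed by arbitrary finite
    types: the parameter tuple [x] need not be injective. *)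
Lemma saturated_finite (kappa : Type) (V W : finType) (x : V -> C)
    (p : set (formula L (V + W))) :
  monster_model kappa C ->
  (forall q, q `<=` p -> finite_set q ->
     exists y, forall phi, q phi -> sat phi (join x y)) ->
  exists y, forall phi, p phi -> sat phi (join x y).
Proof.
move=> CM fin.
pose B : set C := range x.
have finB : finite_set B by apply: finite_image; apply: finite_finset.
have kappa_inf : ([set: nat] #<= [set: kappa])%card.
  apply: card_le_trans (monster_large CM).1.
  pose e (n : nat) := Eq (Var L n) (Var L n).
  have e_inj : {in [set: nat] &, injective e} by move=> m n _ _ [].
  have /card_eqPle[_ le_e] := inj_card_eq e_inj.
  exact: card_le_trans le_e (card_leT _).
have smallB : smaller kappa B.
  split; first by apply: card_le_trans kappa_inf; apply: finite_set_countable.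
  by move=> /(card_le_trans kappa_inf)/infiniteP/(_ finB).
pose f (i : V + W) : 'I_#|W| + B :=
  match i with
  | inl v => inr (SigSub (mem_set (imageT x v)))
  | inr w => inl (enum_rank w)
  end.
have fE y : join y val \o f = join x (y \o enum_rank).
  by apply/funext => -[v|w].
have [|q qp finq|y yP] :=
    @monster_saturated _ _ _ CM B #|W| (rename f @` p); first exact: smallB.
  (* A preimage in [p] of each formula of the finite set [q]. *)
  have [g gP] : {g : formula L ('I_#|W| + B) -> formula L (V + W) &
                 forall psi, q psi -> p (g psi) /\ rename f (g psi) = psi}.
    pose P psi phi := q psi -> p phi /\ rename f phi = psi.
    apply: (@choice _ _ P) => psi; have [/qp[phi pphi E]|nq] := pselect (q psi).
      by exists phi.
    by exists (Bot _ _).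
  have [_ [psi qpsi <-]||y yP] := fin (g @` q).
  - by have [] := gP _ qpsi.
  - exact: finite_image.
  exists (y \o enum_val) => psi qpsi; have [_ <-] := gP _ qpsi.
  apply/sat_rename; rewrite fE.
  have -> : (y \o enum_val) \o enum_rank = y.
    by apply/funext => w /=; rewrite enum_rankK.
  by apply: yP; exists psi.
exists (y \o enum_rank) => phi pphi; rewrite -fE -sat_rename.
by apply: yP; exists phi.
Qed.
End Formulas.

(** * The category of definable sets *)

Section DefinableSpaces.
Variables (L : language) (C : structure L).

(** A definable space: a type identified through [dco] with a definable set of
    finite tuples from [C]. Working with spaces, rather than with sets of
    tuples, makes cartesian products honest product types. *)
Record dspace := DSpace {
  dcar :> Type;
  dvar : finType;
  dco : dcar -> dvar -> C;
  dco_inj : injective dco;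
  dco_definable : definable (range dco) }.

(** Definable subsets of a space, without parameters. *)
Definition ddef (T : dspace) (D : set T) : Prop :=
  exists phi : formula L (dvar T), forall t, D t <-> sat phi (dco t).

Lemma ddefT (T : dspace) : ddef [set: T].
Proof. by exists (Neg (Bot L _)) => t; split=> // _ []. Qed.

Lemma ddefC (T : dspace) (D : set T) : ddef D -> ddef (~` D).
Proof. by move=> [phi H]; exists (Neg phi) => t; rewrite /setC /= H. Qed.

Lemma ddefI (T : dspace) (D E : set T) : ddef D -> ddef E -> ddef (D `&` E).
Proof.
move=> [phi phiP] [psi psiP]; exists (Neg (Imp phi (Neg psi))) => t /=.
split=> [[/phiP Dt /psiP Et] /(_ Dt)/(_ Et)//|H].
apply: contrapT => nDE; apply: H => /phiP Dt /psiP Et; exact: nDE.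
Qed.

Lemma ddefU (T : dspace) (D E : set T) : ddef D -> ddef E -> ddef (D `|` E).
Proof.
by move=> dD dE; rewrite -[D `|` E]setCK setCU; apply/ddefC/ddefI; apply: ddefC.
Qed.

Lemma ddefD (T : dspace) (D E : set T) : ddef D -> ddef E -> ddef (D `\` E).
Proof. by move=> dD dE; apply/ddefI => //; apply: ddefC. Qed.

Definition prod_co (T U : dspace) (z : T * U) : dvar T + dvar U -> C :=
  join (dco z.1) (dco z.2).

Lemma prod_co_inj (T U : dspace) : injective (@prod_co T U).
Proof.
move=> [t u] [t' u'] /funeqP E; congr pair; apply: dco_inj; apply/funext => i.
  exact: E (inl i).
exact: E (inr i).
Qed.

Lemma prod_co_definable (T U : dspace) : definable (range (@prod_co T U)).
Proof.
have [phi phiP] := dco_definable T; have [psi psiP] := dco_definable U.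
pose phi' := rename (@inl _ (dvar U)) phi.
pose psi' := rename (@inr (dvar T) _) psi.
exists (Neg (Imp phi' (Neg psi'))); apply/seteqP; split=> x /=.
  move=> [[t u] _ <-]; apply; apply/sat_rename.
    suff : [set y | sat phi y] (dco t) by [].
    by rewrite -phiP; exists t.
  suff : [set y | sat psi y] (dco u) by [].
  by rewrite -psiP; exists u.
move=> H; have [/sat_rename H1 /sat_rename H2] : sat phi' x /\ sat psi' x.
  by apply: contrapT => n; apply: H => H1 H2; apply: n.
have [t _ tE] : range (@dco T) (x \o inl) by rewrite phiP.
have [u _ uE] : range (@dco U) (x \o inr) by rewrite psiP.
exists (t, u) => //; apply/funext => -[i|i]; rewrite /prod_co /=.
  by rewrite tE.
by rewrite uE.
Qed.

(** The product space; its coordinates are those of the two factors. *)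
Definition dprod (T U : dspace) : dspace :=
  @DSpace (T * U) (dvar T + dvar U)%type (@prod_co T U) (@prod_co_inj T U)
    (prod_co_definable T U).

(** Preimages under maps that only rearrange, duplicate or forget
    coordinates. *)
Lemma ddef_coord (T U : dspace) (f : T -> U) (r : dvar U -> dvar T)
    (D : set U) :
  (forall t, dco (f t) = dco t \o r) -> ddef D -> ddef (f @^-1` D).
Proof.
move=> fr [phi H]; exists (rename r phi) => t.
by rewrite sat_rename -fr; apply: H.
Qed.

Lemma ddef_proj (T U : dspace) (D : set (dprod T U)) :
  ddef D -> ddef [set t : T | exists u : U, D (t, u)].
Proof.
move=> [phi phiP]; have [psi psiP] := dco_definable U.
pose psi' := rename (@inr (dvar T) _) psi.
have [chi chiP] := ex_formula C (Neg (Imp phi (Neg psi'))).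
exists chi => t; rewrite chiP; split=> [[u Dtu]|[y /= H]].
  exists (dco u) => /= /(_ ((phiP (t, u)).1 Dtu)); apply; apply/sat_rename.
  suff : [set y | sat psi y] (dco u) by [].
  by rewrite -psiP; exists u.
have [H1 /sat_rename H2] : sat phi (join (dco t) y) /\
                           sat psi' (join (dco t) y).
  by apply: contrapT => n; apply: H => H1 H2; apply: n.
have [u _ uE] : range (@dco U) y by rewrite psiP.
by exists u; apply/phiP; rewrite /= /prod_co /= uE.
Qed.

Lemma ddef_eq (T : dspace) : ddef [set z : dprod T T | z.1 = z.2].
Proof.
have [phi phiP] := eq_formula C (@inl (dvar T) (dvar T)) inr.
exists phi => -[t u]; rewrite phiP /=; split=> [-> //|E].
by apply: dco_inj; apply/funext.
Qed.

(** Definable functions, described by how they act on definable sets with a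
    further coordinate [P]. This form composes without quantifying over the
    intermediate values; [dfun_graph] derives it from definability of the
    graph. *)
Definition dfun (T U : dspace) (f : T -> U) : Prop :=
  forall (P : dspace) (D : set (dprod U P)),
    ddef D -> ddef [set z : dprod T P | D (f z.1, z.2)].

Lemma dfun_coord (T U : dspace) (f : T -> U) (r : dvar U -> dvar T) :
  (forall t, dco (f t) = dco t \o r) -> dfun f.
Proof.
move=> fr P D dD.
pose s (i : dvar (dprod U P)) : dvar (dprod T P) :=
  match i with inl j => inl (r j) | inr j => inr j end.
apply: (@ddef_coord (dprod T P) (dprod U P) (fun z => (f z.1, z.2)) s) => //.
by move=> [t p]; apply/funext => -[i|i] //=; rewrite /prod_co /= fr.
Qed.

Lemma dfun_fst (T U : dspace) : @dfun (dprod T U) T fst.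
Proof. exact: (@dfun_coord (dprod T U) T fst inl). Qed.

Lemma dfun_snd (T U : dspace) : @dfun (dprod T U) U snd.
Proof. exact: (@dfun_coord (dprod T U) U snd inr). Qed.

Lemma dfun_id (T : dspace) : dfun (@id T).
Proof. exact: (@dfun_coord T T id id). Qed.

Lemma dfun_comp (T U V : dspace) (g : U -> V) (f : T -> U) :
  dfun g -> dfun f -> dfun (g \o f).
Proof. by move=> dg df P D /dg /df. Qed.

Lemma dfun_pair (T U V : dspace) (f : T -> U) (g : T -> V) :
  dfun f -> dfun g -> @dfun T (dprod U V) (fun t => (f t, g t)).
Proof.
move=> df dg P D dD.
pose r1 (i : dvar (dprod (dprod U V) P)) : dvar (dprod U (dprod V P)) :=
  match i with
  | inl (inl i) => inl i | inl (inr j) => inr (inl j) | inr k => inr (inr k)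
  end.
have d1 : ddef [set z : dprod U (dprod V P) | D ((z.1, z.2.1), z.2.2)].
  apply: (@ddef_coord _ (dprod (dprod U V) P) _ r1) dD.
  by move=> [u [v p]]; apply/funext => -[[]|].
pose r2 (i : dvar (dprod T (dprod V P))) : dvar (dprod V (dprod T P)) :=
  match i with
  | inl i => inr (inl i) | inr (inl j) => inl j | inr (inr k) => inr (inr k)
  end.
have d2 : ddef [set z : dprod V (dprod T P) | D ((f z.2.1, z.1), z.2.2)].
  refine (@ddef_coord (dprod V (dprod T P)) (dprod T (dprod V P))
    (fun z => (z.2.1, (z.1, z.2.2))) r2 _ _ (df _ _ d1)).
  by move=> [v [t p]]; apply/funext => -[|[]].
pose r3 (i : dvar (dprod T (dprod T P))) : dvar (dprod T P) :=
  match i with inl i => inl i | inr j => j end.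
refine (@ddef_coord (dprod T P) (dprod T (dprod T P)) (fun z => (z.1, z)) r3
  _ _ (dg _ _ d2)).
by move=> [t p]; apply/funext => -[|[]].
Qed.

Lemma dfun_graph (T U : dspace) (f : T -> U) :
  ddef [set z : dprod T U | z.2 = f z.1] -> dfun f.
Proof.
move=> dgr P D dD.
pose r1 (i : dvar (dprod T U)) : dvar (dprod (dprod T P) U) :=
  match i with inl i => inl (inl i) | inr j => inr j end.
pose r2 (i : dvar (dprod U P)) : dvar (dprod (dprod T P) U) :=
  match i with inl i => inr i | inr j => inl (inr j) end.
have d1 : ddef [set z : dprod (dprod T P) U | z.2 = f z.1.1].
  refine (@ddef_coord (dprod (dprod T P) U) (dprod T U)
    (fun z => (z.1.1, z.2)) r1 _ _ dgr).
  by move=> [[t p] u]; apply/funext => -[].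
have d2 : ddef [set z : dprod (dprod T P) U | D (z.2, z.1.2)].
  refine (@ddef_coord (dprod (dprod T P) U) (dprod U P)
    (fun z => (z.2, z.1.2)) r2 _ _ dD).
  by move=> [[t p] u]; apply/funext => -[].
have := ddef_proj (ddefI d1 d2); congr ddef; apply/seteqP; split=> -[t p] /=.
  by move=> [u [/= -> ]].
by exists (f t).
Qed.

Lemma ddef_preimage (T U : dspace) (f : T -> U) (D : set U) :
  dfun f -> ddef D -> ddef (f @^-1` D).
Proof.
move=> df dD.
have d1 : ddef [set z : dprod U T | D z.1].
  by apply: (@ddef_coord (dprod U T) U fst inl) dD.
pose r (i : dvar (dprod T T)) : dvar T := match i with inl i | inr i => i end.
refine (@ddef_coord T (dprod T T) (fun t => (t, t)) r _ _ (df _ _ d1)).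
by move=> t; apply/funext => -[].
Qed.

Lemma ddef_eqfun (T U : dspace) (f g : T -> U) :
  dfun f -> dfun g -> ddef [set t | f t = g t].
Proof. by move=> df dg; apply: ddef_preimage (dfun_pair df dg) (ddef_eq U). Qed.

(** * Compactness and type-definable sets *)

(** Downward directed, nonempty families of sets. *)
Definition directed (T : Type) (F : set (set T)) : Prop :=
  (exists D, F D) /\
  forall D E, F D -> F E -> exists2 D', F D' & D' `<=` D `&` E.

Lemma directed_finite (T : Type) (F Q : set (set T)) :
  directed F -> finite_set Q -> (forall E, Q E -> exists2 D, F D & D `<=` E) ->
  exists2 D, F D & forall E, Q E -> D `<=` E.
Proof.
move=> [[D0 FD0] FI] /finite_seqP[s ->] {Q}.
elim: s => [|E s IH] H; first by exists D0.
have [|D FD DP] := IH.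
  by move=> E' sE'; apply: H; rewrite /= inE sE' orbT.
have [D' FD' D'E] := H E (mem_head _ _).
have [D'' FD'' sub] := FI _ _ FD FD'.
exists D'' => // E' /=; rewrite inE => /orP[/eqP->|sE'] t /sub[Dt D't].
  exact: D'E.
exact: DP sE' _ Dt.
Qed.

(** The type-definable subsets of a space are the intersections of definable
    ones; the definable supersets then form a canonical such family. *)
Definition tdef (T : dspace) (S : set T) : Prop :=
  forall t, (forall D, ddef D -> S `<=` D -> D t) -> S t.

Definition dsuper (T : dspace) (S : set T) : set (set T) :=
  [set D | ddef D /\ S `<=` D].

Lemma dsuper_directed (T : dspace) (S : set T) : directed (dsuper S).
Proof.
split; first by exists setT; split=> //; apply: ddefT.
move=> D E [dD SD] [dE SE]; exists (D `&` E) => //.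
by split; [apply: ddefI | move=> t St; split; [apply: SD | apply: SE]].
Qed.

(** The formulas satisfied by all of [S] include one that defines the image of
    [T], so that no separate condition of belonging to [T] is needed. *)
Lemma tdefP (T : dspace) (S : set T) :
  tdef S <-> type_definable (@dco T @` S).
Proof.
split=> [tS|[p pE] t H].
  exists [set phi | forall t, S t -> sat phi (dco t)].
  apply/seteqP; split=> [_ [t St <-] phi /(_ _ St)//|x H].
  have [phi phiP] := dco_definable T.
  have [t _ tE] : range (@dco T) x.
    rewrite phiP; apply: H => t St.
    suff : [set y | sat phi y] (dco t) by [].
    by rewrite -phiP; exists t.
  exists t => //; apply: tS => D [psi psiP] SD; apply/psiP; rewrite tE.
  by apply: H => u /SD/psiP.
suff : (@dco T @` S) (dco t) by move=> [u Su /dco_inj <-].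
rewrite pE => phi pphi; apply: (H [set u | sat phi (dco u)]).
  by exists phi.
move=> u Su; have : (@dco T @` S) (dco u) by exists u.
by rewrite pE; apply.
Qed.

Lemma ddef_tdef (T : dspace) (D : set T) : ddef D -> tdef D.
Proof. by move=> dD t; apply. Qed.

Lemma tdefI (T : dspace) (S R : set T) : tdef S -> tdef R -> tdef (S `&` R).
Proof.
by move=> tS tR t H; split; [apply: tS | apply: tR] => D dD SD;
  apply: H => // u [? ?]; apply: SD.
Qed.

Lemma tdefU (T : dspace) (S R : set T) : tdef S -> tdef R -> tdef (S `|` R).
Proof.
move=> tS tR t H; apply: contrapT => nSR.
have nS : ~ S t by move=> St; apply: nSR; left.
apply: nSR; right; apply: tR => D dD RD.
apply: contrapT => nDt; apply: nS; apply: tS => E dE SE.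
have [||//|//] := H (E `|` D); first exact: ddefU.
by move=> u [/SE|/RD]; [left|right].
Qed.

Lemma tdef_preimage (T U : dspace) (f : T -> U) (S : set U) :
  dfun f -> tdef S -> tdef (f @^-1` S).
Proof.
move=> df tS t H; apply: tS => D dD SD.
apply: (H (f @^-1` D)); first exact: ddef_preimage.
by move=> u Su; apply: SD.
Qed.

Variables (kappa : Type) (CM : monster_model kappa C).

(** Saturation, in terms of definable spaces. *)
Lemma compactness (T U : dspace) (t : T) (F : set (set (dprod T U))) :
  directed F -> (forall D, F D -> ddef D) ->
  (forall D, F D -> exists u, D (t, u)) ->
  exists u, forall D, F D -> D (t, u).
Proof.
move=> dirF dF exF; have [psi psiP] := dco_definable U.
pose p : set (formula L (dvar T + dvar U)) :=
  [set phi | exists2 D, F D & forall u, D (t, u) -> sat phi (prod_co (t, u))].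
have [q qp finq|y yP] := @saturated_finite _ _ _ _ _ (dco t) p CM.
  (* The subset of [T * U] that [phi] defines in the fiber over [t]. *)
  pose sec (phi : formula L (dvar T + dvar U)) : set (dprod T U) :=
    [set z | z.1 = t -> sat phi (prod_co z)].
  have [|D FD DP] := directed_finite dirF (finite_image sec finq).
    move=> _ [phi /qp[D FD DP] <-]; exists D => // -[t' u] Dtu /= E.
    have Et : t' = t := E.
    by rewrite Et in Dtu *; apply: DP.
  have [u Dtu] := exF D FD; exists (dco u) => phi qphi.
  by have /(_ (t, u) Dtu erefl) : D `<=` sec phi by apply: DP; exists phi.
have [[D0 FD0] _] := dirF.
have [u _ uE] : range (@dco U) y.
  rewrite psiP; apply: (sat_rename psi inr (join (dco t) y)).1; apply: yP.
  exists D0 => // u _; apply/sat_rename.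
  suff : [set y | sat psi y] (dco u) by [].
  by rewrite -psiP; exists u.
exists u => D FD; have [phi phiP] := dF D FD.
apply/phiP; rewrite /= /prod_co uE.
by apply: yP; exists D => // v /phiP.
Qed.

Lemma compactness_no_param (U : dspace) (F : set (set U)) :
  directed F -> (forall D, F D -> ddef D) -> (forall D, F D -> exists u, D u) ->
  exists u, forall D, F D -> D u.
Proof.
move=> [[D0 FD0] FI] dF exF; have [u0 _] := exF _ FD0.
pose F' : set (set (dprod U U)) := [set snd @^-1` D | D in F].
have [||_ [D /exF[u Du] <-]|u uP] := @compactness _ _ u0 F'.
- split; first by exists (snd @^-1` D0), D0.
  move=> _ _ [D FD <-] [E FE <-]; have [D' FD' sub] := FI _ _ FD FE.
  by exists (snd @^-1` D'); [exists D' | move=> z /sub].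
- by move=> _ [D /dF dD <-]; apply: ddef_preimage dD; apply: dfun_snd.
- by exists u.
by exists u => D FD; apply: (uP (snd @^-1` D)); exists D.
Qed.

(** If the fiber over [t] of every definable superset of [S] is inhabited, then
    by compactness so is that of [S]. *)
Lemma tdef_proj (T U : dspace) (S : set (dprod T U)) :
  tdef S -> tdef [set t : T | exists u : U, S (t, u)].
Proof.
move=> tS t H; have [|D []//|D [dD SD]|u uP] :=
  @compactness _ _ t (dsuper S); first exact: dsuper_directed.
  by apply: (H _ (ddef_proj dD)) => t' [u /SD]; exists u.
by exists u; apply: tS => D dD SD; apply: uP.
Qed.
End DefinableSpaces.

(** * Generic and wide subsets of a group *)

Section Wide.
Local Open Scope group_scope.
Variables (T : groupType) (K : set T) (K_subgroup : subgroup K).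

(** The left translate [g * D]. *)
Definition translate (g : T) (D : set T) : set T := [set x | D (g^-1 * x)].

(** Finitely many translates of [D] by elements of [K] cover [K]. *)
Definition generic (D : set T) : Prop :=
  exists2 s : seq T, (forall g, g \in s -> K g) &
    forall x, K x -> exists2 g, g \in s & translate g D x.

(** [D] is wide (weakly generic, but with an arbitrary complementing set) when
    it is indispensable in some generic set. *)
Definition wide (D : set T) : Prop :=
  exists2 P, generic (D `|` P) & ~ generic P.

Lemma generic_sub (D E : set T) :
  (forall x, K x -> D x -> E x) -> generic D -> generic E.
Proof.
have [_ KM KV] := K_subgroup.
move=> DE [s sK sD]; exists s => // x Kx; have [g gs Dg] := sD x Kx.
exists g => //; apply: DE => //.
by apply: KM => //; apply/KV/sK.
Qed.

Lemma generic_translates (s : seq T) (D : set T) :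
  (forall g, g \in s -> K g) ->
  generic [set x | exists2 g, g \in s & translate g D x] -> generic D.
Proof.
have [_ KM _] := K_subgroup.
move=> sK [r rK rD]; exists [seq h * g | h <- r, g <- s].
  by move=> _ /allpairsP[[h g] [/rK hr /sK gs ->]]; apply: KM.
move=> x /rD[h hr [g gs Dx]]; exists (h * g).
  by apply/allpairsP; exists (h, g).
by move: Dx; rewrite /translate /= invgM mulgA.
Qed.

Lemma generic_translate (g : T) (D : set T) :
  K g -> generic (translate g D) -> generic D.
Proof.
move=> Kg gD; apply: (@generic_translates [:: g]) => [h|].
  by rewrite inE => /eqP->.
by apply: generic_sub gD => x Kx Dx; exists g; rewrite ?mem_head.
Qed.

Lemma wide_sub (D E : set T) :
  (forall x, K x -> D x -> E x) -> wide D -> wide E.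
Proof.
move=> DE [P gDP nP]; exists P => //; apply: generic_sub gDP => x Kx.
by move=> [/(DE _ Kx)|]; [left|right].
Qed.

Lemma wideU (D E : set T) : wide (D `|` E) -> wide D \/ wide E.
Proof.
move=> [P gDEP nP]; have [gEP|nEP] := pselect (generic (E `|` P)).
  by right; exists P.
by left; exists (E `|` P) => //; rewrite setUA.
Qed.

Lemma wide_nonempty (D : set T) : wide D -> exists2 x, K x & D x.
Proof.
move=> [P gDP nP]; apply: contrapT => nD; apply: nP.
by apply: generic_sub gDP => x Kx [Dx|//]; case: nD; exists x.
Qed.

Lemma wide_finite_union (I : eqType) (s : seq I) (D : I -> set T) :
  wide [set x | exists2 i, i \in s & D i x] -> exists2 i, i \in s & wide (D i).
Proof.
elim: s => [|i s IH] wD.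
  by have [x _ [i]] := wide_nonempty wD.
have [|wi|wE] := @wideU (D i) [set x | exists2 j, j \in s & D j x].
- apply: wide_sub wD => x _ [j].
  rewrite inE => /orP[/eqP->|js] Dx; first by left.
  by right; exists j.
- by exists i; rewrite ?mem_head.
by have [j js wj] := IH wE; exists j; rewrite // inE js orbT.
Qed.

Lemma wide_translate (g : T) (D : set T) :
  K g -> wide (translate g D) -> wide D.
Proof.
have [_ _ KV] := K_subgroup.
move=> Kg [P gDP nP]; exists (translate g^-1 P).
  apply: (generic_translate Kg); congr generic: gDP.
  by apply/funext => x; rewrite /translate /= invgK mulVKg.
by move=> gP; apply: nP; apply: generic_translate gP; apply: KV.
Qed.

Lemma wideT : wide [set: T].
Proof.
have [K1 _ _] := K_subgroup.
exists set0; last by move=> [s _ /(_ _ K1)[]].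
exists [:: 1] => [g|x _]; first by rewrite inE => /eqP->.
by exists 1; rewrite ?mem_head //; left.
Qed.

(** If the translates of [D `|` P] by [s] cover [K], with [P] not generic, then
    for every [h] the part of [K] outside the translates of [P] by [s] and by
    [h * s] is still wide, and it is covered by the translates of [D] both by
    [s] and by [h * s]. *)
Lemma wide_translates_meet (D : set T) : wide D ->
  exists2 s : seq T, (forall g, g \in s -> K g) &
    forall h, K h -> exists g g', [/\ g \in s, g' \in s &
      wide (translate g D `&` translate (h * g') D)].
Proof.
have [K1 KM KV] := K_subgroup.
move=> [P [s sK sDP] nP]; exists s => // h Kh.
pose r := s ++ [seq h * g | g <- s].
have rK g : g \in r -> K g.
  by rewrite mem_cat => /orP[/sK//|/mapP[g' /sK gs ->]]; apply: KM.
pose meet (p : T * T) := translate p.1 D `&` translate (h * p.2) D.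
have [[g g'] /allpairsP[[k k'] [ks k's [-> ->]]] wm] :
    exists2 p, p \in [seq (g, g') | g <- s, g' <- s] & wide (meet p).
  apply: wide_finite_union.
  exists [set x | exists2 g, g \in r & translate g P x]; last first.
    by move/(generic_translates rK).
  exists [:: 1] => [g|x Kx]; first by rewrite inE => /eqP->.
  exists 1; rewrite ?mem_head // /translate /= invg1 mul1g.
  have [g gs [Dg|Pg]] := sDP x Kx; last first.
    by right; exists g; rewrite // mem_cat gs.
  have [g' g's [Dg'|Pg']] := sDP (h^-1 * x) (KM _ _ (KV _ Kh) Kx); last first.
    right; exists (h * g'); first by rewrite mem_cat map_f ?orbT.
    by rewrite /translate /= invgM -mulgA.
  left; exists (g, g'); first by apply/allpairsP; exists (g, g').
  by split=> //=; rewrite /translate /= invgM -mulgA.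
by exists k, k'.
Qed.
End Wide.

(** * Coverings of a type-definable group by type-definable sets *)

Section Newelski.
Local Open Scope group_scope.
Variables (L : language) (C : structure L) (kappa : Type).
Variable CM : monster_model kappa C.
Variables (T : groupType) (W : finType) (co : T -> W -> C).
Variables (co_inj : injective co) (co_definable : definable (range co)).
Let X : dspace C := DSpace co_inj co_definable.
Variable mul_dfun : @dfun _ _ (dprod X X) X (fun z : T * T => z.1 * z.2).
Variables (K : set T) (K_subgroup : subgroup K) (K_tdef : @tdef _ _ X K).
Variables (V : nat -> set T) (V_tdef : forall n, @tdef _ _ X (V n)).
Variable K_cover : K `<=` \bigcup_n V n.

(** Baire category: among the wide definable sets, some [D] has all its wide
    definable subsets meeting one and the same [V n]. Otherwise a decreasing
    sequence of wide definable sets would avoid all [V n] in turn, and by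
    compactness there would be an element of [K] outside every [V n]. *)
Lemma wide_somewhere : exists D n,
  [/\ @ddef _ _ X D, wide K D &
      forall E, @ddef _ _ X E -> E `<=` D -> wide K E ->
        exists2 x, E x & V n x].
Proof.
apply: contrapT => none.
pose P (p : nat * set T) (E : set T) := @ddef _ _ X p.2 -> wide K p.2 ->
  [/\ @ddef _ _ X E, wide K E, E `<=` p.2 & forall x, E x -> ~ V p.1 x].
have [F FP] : {F & forall p, P p (F p)}.
  apply: (@choice _ _ P) => -[n D]; apply: contrapT => nE.
  have dD : @ddef _ _ X D.
    by apply: contrapT => H; apply: nE; exists D => d _; case: (H d).
  have wD : wide K D.
    by apply: contrapT => H; apply: nE; exists D => _ w; case: (H w).
  apply: none; exists D, n; split=> // E dE ED wE; apply: contrapT => nV.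
  by apply: nE; exists E => _ _; split=> // x Ex Vx; apply: nV; exists x.
pose D := fix D n := if n is m.+1 then F (m, D m) else [set: T].
have DP n : @ddef _ _ X (D n) /\ wide K (D n).
  elim: n => [|n [dD wD]]; first by split; [apply: ddefT | apply: wideT].
  by have [] := FP (n, D n) dD wD.
have D_le m n : (m <= n)%N -> D n `<=` D m.
  move/subnK <-; elim: (n - m)%N => [//|k IH] x Dx; apply: IH.
  by have [dD wD] := DP (k + m)%N; 
    have [_ _ sub _] := FP ((k + m)%N, D (k + m)%N) dD wD; exact: sub Dx.
pose Fam : set (set X) :=
  [set E | exists n S, dsuper (T := X) K S /\ E = D n `&` S].
have [||_ [n [S [[_ KS] ->]]]|x xP] := compactness_no_param CM (F := Fam).
- split.
    exists (D 0 `&` setT), 0%N, setT.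
    by split=> //; split=> //; apply: ddefT.
  move=> _ _ [n [S [KS ->]]] [m [R [KR ->]]].
  have [_ /(_ _ _ KS KR)[Q KQ QSR]] := dsuper_directed (T := X) K.
  exists (D (maxn n m) `&` Q); first by exists (maxn n m), Q.
  move=> x [Dx /QSR[Sx Rx]]; split; split=> //.
    exact: D_le (leq_maxl _ _) _ Dx.
  exact: D_le (leq_maxr _ _) _ Dx.
- move=> _ [n [S [[dS _] ->]]]; apply: ddefI => //; exact: (DP n).1.
- have [x Kx Dx] := wide_nonempty K_subgroup (DP n).2.
  by exists x; split=> //; apply: KS.
have Kx : K x.
  apply: K_tdef => S dS KS; have [] // : (D 0 `&` S) x.
  by apply: xP; exists 0%N, S.
have [n _ Vx] := K_cover Kx.
have [dD wD] := DP n; have [_ _ _ /(_ x)] := FP (n, D n) dD wD; apply => //.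
have [] // : (D n.+1 `&` setT) x.
by apply: xP; exists n.+1, setT; split=> //; split=> //; apply: ddefT.
Qed.

(** Newelski's theorem: finitely many two-sided translates of some
    [V n * (V n)^-1] cover [K]. *)
Theorem type_definable_cover : exists n, exists2 s : seq T,
  (forall g, g \in s -> K g) &
  forall h, K h -> exists g g' x y, [/\ g \in s, g' \in s, V n x, V n y &
    h = g * x * y^-1 * g'^-1].
Proof.
have [D [n [dD wD DV]]] := wide_somewhere.
have [s sK sP] := wide_translates_meet K_subgroup wD.
exists n; exists s => // h Kh; have [g [g' [gs g's wm]]] := sP h Kh.
have [_ KM _] := K_subgroup.
have Kg := sK _ gs; have Khg' : K (h * g') by apply: KM => //; apply: sK.
pose u := (h * g')^-1 * g.
(* The part of [D] outside a definable superset [S] of [V n] is not wide, so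
   [D] may be replaced by [S] in [wm]; and [g * y = h * g' * (u * y)]. *)
have meet S : dsuper (T := X) (V n) S -> exists y, S y /\ S (u * y).
  move=> [dS VS].
  have nw : ~ wide K (D `\` S).
    move=> wDS.
    by have [x [_ nSx] /VS] := DV _ (ddefD dD dS) (@subDsetl _ _ _) wDS.
  pose I := translate g S `&` translate (h * g') S.
  pose J := translate g (D `\` S) `|` translate (h * g') (D `\` S).
  have nJ : ~ wide K J 
    by move/wideU => [] w; apply/nw/(wide_translate K_subgroup _ w).
  have /wideU[wI|//] : wide K (I `|` J).
    apply: (wide_sub K_subgroup) wm => x _ [Dx Dx'].
    have [Sx|nSx] := pselect (translate g S x); last by right; left.
    by have [Sx'|nSx'] := pselect (translate (h * g') S x);
      [left | right; right].
  have [x _ [Sx Sx']] := wide_nonempty K_subgroup wI.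
  by exists (g^-1 * x); rewrite /u -mulgA mulVKg.
pose Fam : set (set (dprod X X)) :=
  [set E | exists2 S, dsuper (T := X) (V n) S &
     E = snd @^-1` S `&` (fun z => z.1 * z.2) @^-1` S].
have [||_ [S VS ->]|y yP] := compactness CM (t := u : X) (F := Fam).
- have [[S VS] VI] := dsuper_directed (T := X) (V n).
  split; first by eexists; exists S.
  move=> _ _ [Q VQ ->] [R VR ->]; have [S' VS' sub] := VI _ _ VQ VR.
  eexists; first by exists S'.
  by move=> [x y] [/sub[? ?] /sub[? ?]].
- move=> _ [S [dS _] ->]; apply: ddefI; last exact: ddef_preimage dS.
  by apply: ddef_preimage dS; apply: dfun_snd.
- by have [y [Sy Suy]] := meet S VS; exists y.
exists g, g', y, (u * y); split=> //.
- apply: V_tdef => S dS VS.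
  by have [] := yP _ (ex_intro2 _ _ S (conj dS VS) erefl).
- apply: V_tdef => S dS VS.
  by have [] := yP _ (ex_intro2 _ _ S (conj dS VS) erefl).
by rewrite /u !invgM !invgK !mulgA !mulgK mulgV mul1g.
Qed.
End Newelski.

(** * Type-definable subsets of a definable group *)

Section TypeDefinableSubsets.
Local Open Scope group_scope.
Variables (L : language) (C : structure L) (kappa : Type).
Variable CM : monster_model kappa C.
Variables (T : groupType) (W : finType) (co : T -> W -> C).
Variables (co_inj : injective co) (co_definable : definable (range co)).
Let X : dspace C := DSpace co_inj co_definable.
Variable mul_dfun : @dfun _ _ (dprod X X) X (fun z : T * T => z.1 * z.2).

(** The unit is the only idempotent, whence it is definable from the product. *)
Lemma ddef_one : @ddef _ _ X [set 1].
Proof.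
have -> : [set 1] = [set x : T | x * x = x].
  apply/seteqP; split=> [_ ->|x /= xx]; first by rewrite /= mulg1.
  by rewrite -[LHS](mulKg x) xx mulVg.
apply: (@ddef_eqfun _ _ X X (fun x : T => x * x) id); last exact: dfun_id.
exact: (dfun_comp mul_dfun (dfun_pair (@dfun_id _ _ X) (@dfun_id _ _ X))).
Qed.

Lemma tdef_mul (S R : set T) : @tdef _ _ X S -> @tdef _ _ X R ->
  @tdef _ _ X [set z | exists p : T * T, [/\ S p.1, R p.2 & z = p.1 * p.2]].
Proof.
move=> tS tR.
have f1 := @dfun_fst _ _ X (dprod X X); have f2 := @dfun_snd _ _ X (dprod X X).
have d : @ddef _ _ (dprod X (dprod X X)) [set z | z.1 = z.2.1 * z.2.2].
  exact: ddef_eqfun f1 (dfun_comp mul_dfun f2).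
have t1 := tdef_preimage (dfun_comp (@dfun_fst _ _ X X) f2) tS.
have t2 := tdef_preimage (dfun_comp (@dfun_snd _ _ X X) f2) tR.
have := tdef_proj CM (tdefI (tdefI t1 t2) (ddef_tdef d)).
congr tdef; apply/seteqP; split=> z [p].
  by move=> [[? ?] ?]; exists p.
by move=> [? ? ?]; exists p.
Qed.

Lemma tdef_quotient (S : set T) : @tdef _ _ X S ->
  @tdef _ _ X [set z | exists p : T * T, [/\ S p.1, S p.2 & z = p.1 * p.2^-1]].
Proof.
move=> tS.
have f1 := @dfun_fst _ _ X (dprod X X); have f2 := @dfun_snd _ _ X (dprod X X).
have g1 := dfun_comp (@dfun_fst _ _ X X) f2.
have g2 := dfun_comp (@dfun_snd _ _ X X) f2.
have d : @ddef _ _ (dprod X (dprod X X)) [set z | z.1 * z.2.2 = z.2.1].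
  exact: ddef_eqfun (dfun_comp mul_dfun (dfun_pair f1 g2)) g1.
have t1 := tdef_preimage g1 tS; have t2 := tdef_preimage g2 tS.
have := tdef_proj CM (tdefI (tdefI t1 t2) (ddef_tdef d)).
congr tdef; apply/seteqP; split=> z [p].
  by move=> [[? ?] /= E]; exists p; split=> //; rewrite -E mulgK.
by move=> [? ? /= ->]; exists p; split=> //=; rewrite mulgVK.
Qed.

(** A subgroup generated by countably many type-definable sets is the union of
    an increasing sequence of type-definable sets. *)
Lemma generated_exhaustion (Z : nat -> set T) :
  (forall n, @tdef _ _ X (Z n)) ->
  exists Y : nat -> set T, [/\ forall n, @tdef _ _ X (Y n),
    forall n, Y n 1, forall m n, (m <= n)%N -> Y m `<=` Y n,
    forall n x y, Y n x -> Y n y -> Y n.+1 (x * y^-1) &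
    generated_subgroup (\bigcup_n Z n) = \bigcup_n Y n].
Proof.
move=> tZ.
pose quo (S : set T) :=
  [set z | exists p : T * T, [/\ S p.1, S p.2 & z = p.1 * p.2^-1]].
pose Y := fix Y n := if n is m.+1 then quo (Y m `|` Z m) else [set 1].
have Y1 n : Y n 1.
  elim: n => [//|n IH]; exists (1, 1); rewrite invg1 mulg1.
  by split=> //; left.
have YS n x : (Y n `|` Z n) x -> Y n.+1 x.
  by move=> Hx; exists (x, 1); split; rewrite ?invg1 ?mulg1 //; left.
have Yle m n : (m <= n)%N -> Y m `<=` Y n.
  move/subnK <-; elim: (n - m)%N => [//|k IH] x /IH Yx.
  by rewrite addSn; apply: YS; left.
have Yq n x y : Y n x -> Y n y -> Y n.+1 (x * y^-1).
  by move=> Yx Yy; exists (x, y); split=> //; left.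
have YV n x : Y n x -> Y n.+1 x^-1.
  by move=> Yx; rewrite -[x^-1]mul1g; apply: Yq.
exists Y; split=> //.
  elim=> [|n IH]; first exact: ddef_tdef ddef_one.
  by apply: tdef_quotient; apply: tdefU.
apply/seteqP; split.
  apply: smallest_sub; last first.
    by move=> x [n _ Zx]; exists n.+1 => //; apply: YS; right.
  split=> [|x y [m _ Yx] [n _ Yy]|x [n _ Yx]].
  - by exists 0%N.
  - exists (maxn m n).+2 => //; rewrite -[y]invgK; apply: Yq.
      by apply: Yle Yx; apply: leqW; apply: leq_maxl.
    by apply: YV; apply: Yle Yy; apply: leq_maxr.
  - by exists n.+1 => //; apply: YV.
move=> x [n _ Yx] M [[M1 MM MV] ZM] /=.
elim: n x Yx => [x ->//|n IH _ [[x y] /= [Hx Hy ->]]].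
have sub z : (Y n `|` Z n) z -> M z.
  by move=> [/IH//|Zz]; apply: ZM; exists n.
by apply: MM; [|apply: MV]; apply: sub.
Qed.
End TypeDefinableSubsets.

(** * Definable extensions *)

Section DefinableExtension.
Variables (L : language) (C : structure L).

Lemma coord_inj (X : def_set C) : injective (coord X).
Proof. exact: val_inj. Qed.

Lemma coord_definable (X : def_set C) : definable (range (coord X)).
Proof.
have [phi domE] := dom_definable X; exists phi; rewrite -domE.
apply/seteqP; split=> [_ [x _ <-]|x Dx]; first exact: set_valP.
by exists (SigSub (mem_set Dx)).
Qed.

(** The space of points of a definable set. *)
Definition set_space (X : def_set C) : dspace C :=
  DSpace (@coord_inj X) (coord_definable X).

Lemma definable_map2_dfun (X Y Z : def_set C) (f : X -> Y -> Z) :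
  definable_map2 f ->
  @dfun _ _ (dprod (set_space X) (set_space Y)) (set_space Z)
    (fun z => f z.1 z.2).
Proof.
move=> [phi phiP]; apply: dfun_graph; exists phi => -[[x y] z] /=.
have -> : sat phi (prod_co (T := dprod (set_space X) (set_space Y))
    (U := set_space Z) ((x, y), z)) = [set u | sat phi u] (prod_co
    (T := dprod (set_space X) (set_space Y)) (U := set_space Z) ((x, y), z)).
  by [].
rewrite -phiP; split=> [->|[x' _ [y' _]]]; first by exists x => //; exists y.
by move/(@prod_co_inj _ _ (dprod (set_space X) (set_space Y)) (set_space Z)
  ((x', y'), f x' y') ((x, y), z)) => [-> -> ->].
Qed.

Variables (G : def_group C) (A : def_abgroup C) (E : def_extension G A).

Let spaceA := set_space (aset A).
Let spaceG := set_space (gset G).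

Lemma ext_coord_inj : injective (ext_coord E).
Proof. exact: (@prod_co_inj _ _ spaceA spaceG). Qed.

Lemma ext_coord_definable : definable (range (ext_coord E)).
Proof. exact: (prod_co_definable spaceA spaceG). Qed.

(** The product of the spaces of [A] and [G], presented with carrier [ext E] so
    that the group structure of the extension applies to it. *)
Definition ext_space : dspace C := DSpace ext_coord_inj ext_coord_definable.

Lemma dfun_ext1 : @dfun _ _ ext_space spaceA (fun x : ext E => x.1).
Proof. exact: (@dfun_coord _ _ ext_space spaceA _ inl). Qed.

Lemma dfun_ext2 : @dfun _ _ ext_space spaceG (fun x : ext E => x.2).
Proof. exact: (@dfun_coord _ _ ext_space spaceG _ inr). Qed.

Lemma dfun_ext_mul :
  @dfun _ _ (dprod ext_space ext_space) ext_space
    (fun z : ext E * ext E => (z.1 * z.2)%g).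
Proof.
have fA := definable_map2_dfun (@aadd_definable _ _ A).
have fG := definable_map2_dfun (@gmul_definable _ _ G).
have fact := definable_map2_dfun (@act_definable _ _ _ _ E).
have fh := definable_map2_dfun (@cocycle_definable _ _ _ _ E).
have p1 := @dfun_fst _ _ ext_space ext_space.
have p2 := @dfun_snd _ _ ext_space ext_space.
have a1 := dfun_comp dfun_ext1 p1; have g1 := dfun_comp dfun_ext2 p1.
have a2 := dfun_comp dfun_ext1 p2; have g2 := dfun_comp dfun_ext2 p2.
have ga := dfun_comp fact (dfun_pair g1 a2).
have s := dfun_comp fA (dfun_pair a1 ga).
have h := dfun_comp fh (dfun_pair g1 g2).
exact: (dfun_pair (dfun_comp fA (dfun_pair s h))
  (dfun_comp fG (dfun_pair g1 g2))).
Qed.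

Lemma ddef_pi_eq1 : @ddef _ _ ext_space [set x : ext E | x.2 = 1%g].
Proof.
have mulG := definable_map2_dfun (@gmul_definable _ _ G).
have d1 : @ddef _ _ spaceG [set (1%g : G)].
  exact: (@ddef_one _ _ G _ _ _ _ mulG).
exact: (ddef_preimage dfun_ext2 d1).
Qed.
End DefinableExtension.

Theorem theorem5p2 (kappa : Type) (L : language) (C : structure L)
    (C_monster : monster_model kappa C)
    (G : def_group C) (A : def_abgroup C) (E : def_extension G A)
    (Ht Hbar : set (ext E))
    (Ht_normal : normal_subgroup Ht)
    (Ht_invariant : aut_invariant (ext_coord E @` Ht))
    (Ht_bounded_index : smaller kappa (lcosets Ht))
    (Ht_generated : exists2 X : nat -> set (ext E),
       forall n, type_definable (ext_coord E @` X n) &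
       Ht = generated_subgroup (\bigcup_n X n))
    (Hbar_subgroup : subgroup Hbar)
    (Hbar_type_definable : type_definable (ext_coord E @` Hbar))
    (Ht_sub_Hbar : Ht `<=` Hbar) :
  let AH : set A := ext_in E @^-1` Hbar in
  let H : set G := ext_pi E @` Hbar in
  let HtA : set A := ext_in E @^-1` Ht in
  H = ext_pi E @` Ht ->
  (forall g a, H g -> AH a -> HtA (act E g a - a)%R) ->
  type_definable (coord (aset A) @` HtA) ->
  type_definable (ext_coord E @` Ht).
Proof.
move=> AH H HtA HE _ HtA_td.
have tHbar : @tdef _ _ (ext_space E) Hbar by apply/tdefP.
have tHtA : @tdef _ _ (set_space (aset A)) HtA by apply/tdefP.
have [X X_td Ht_gen] := Ht_generated.
have tX n : @tdef _ _ (ext_space E) (X n) by apply/tdefP.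
have mulE := @dfun_ext_mul _ _ _ _ E.
have [Y [tY Y1 Yle Yq HtE]] := generated_exhaustion C_monster mulE tX.
rewrite -Ht_gen in HtE.
have YHt n : Y n `<=` Ht by move=> x Yx; rewrite HtE; exists n.
have [[Ht1 HtM HtV] _] := Ht_normal.
(* The part of [Hbar] lying over the projection of [Y n]. *)
pose V n := [set x | Hbar x /\ exists2 y, Y n y & ext_pi E x = ext_pi E y].
have tV n : @tdef _ _ (ext_space E) (V n).
  apply: tdefI => //.
  have p1 := @dfun_fst _ _ (ext_space E) (ext_space E).
  have p2 := @dfun_snd _ _ (ext_space E) (ext_space E).
  have d := ddef_eqfun (dfun_comp (@dfun_ext2 _ _ _ _ E) p1)
                       (dfun_comp (@dfun_ext2 _ _ _ _ E) p2).
  have := tdef_proj C_monster (tdefI (tdef_preimage p2 (tY n)) (ddef_tdef d)).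
  congr tdef; apply/seteqP; split=> [x [y [Yy xy]]|x [y Yy xy]].
    by exists y.
  by exists y.
have V_cover : Hbar `<=` \bigcup_n V n.
  move=> x Hx; have : H (ext_pi E x) by exists x.
  rewrite HE => -[y]; rewrite HtE => -[n _ Yy] yx.
  by exists n => //; split=> //; exists y.
have [n [s sH sP]] :=
  type_definable_cover C_monster mulE Hbar_subgroup tHbar tV V_cover.
(* The finitely many translating elements all lie in one [V m]. *)
have [m mP] : exists m, forall g, g \in s -> V m g.
  elim: s sH {sP} => [|g s IH] sH; first by exists 0%N.
  have [m mP] : exists m, forall g, g \in s -> V m g.
    by apply: IH => g' gs; apply: sH; rewrite inE gs orbT.
  have [k _ [Hg [y Yy gy]]] : (\bigcup_n V n) g by apply/V_cover/sH/mem_head.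
  exists (maxn k m) => g'; rewrite inE => /orP[/eqP->|/mP[Hg' [y' Yy' gy']]].
    by split=> //; exists y => //; apply: Yle Yy; apply: leq_maxl.
  by split=> //; exists y' => //; apply: Yle Yy'; apply: leq_maxr.
pose N := maxn m n.
have YM x y : Y N x -> Y N y -> Y N.+2 (x * y)%g.
  move=> Yx Yy; rewrite -[y]invgK; apply: (Yq).
    exact: Yle (leqnSn _) _ Yx.
  by rewrite -[(y^-1)%g]mul1g; apply: Yq.
have lift k x : (k <= N)%N -> V k x ->
    exists2 y, Y N y & ext_pi E x = ext_pi E y.
  by move=> kN [_ [y Yy xy]]; exists y => //; apply: Yle kN _ Yy.
have piY h : Hbar h -> exists2 y, Y N.+3 y & ext_pi E h = ext_pi E y.
  move=> /sP[g [g' [x [y [/mP Vg /mP Vg' Vx Vy ->]]]]].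
  have [a Ya ga] := lift _ _ (leq_maxl m n) Vg.
  have [a' Ya' ga'] := lift _ _ (leq_maxl m n) Vg'.
  have [b Yb xb] := lift _ _ (leq_maxr m n) Vx.
  have [b' Yb' yb'] := lift _ _ (leq_maxr m n) Vy.
  exists (a * b * (a' * b')^-1)%g; first by apply: Yq; apply: YM.
  have piM u v : ext_pi E (u * v)%g = (ext_pi E u * ext_pi E v)%g by [].
  have piV u : ext_pi E (u^-1)%g = ((ext_pi E u)^-1)%g by [].
  by rewrite !(piM, piV) ga ga' xb yb' invgM !mulgA.
apply/(@tdefP _ _ (ext_space E)).
have tAt : @tdef _ _ (ext_space E) (ext_in E @` HtA).
  have := tdefI (ddef_tdef (ddef_pi_eq1 E))
                (tdef_preimage (@dfun_ext1 _ _ _ _ E) tHtA).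
  congr tdef; apply/seteqP; split=> [[a g] [/= -> Ha]|_ [a Ha <-]]; last by [].
  by exists a.
(* [Ht] is the product of [Y N.+3] and its intersection with [A]. *)
have := tdef_mul C_monster mulE (tY N.+3) tAt.
congr tdef; apply/seteqP; split=> [_ [[x _] [/= /YHt Hx [a Ha <-] ->]]|z Hz].
  exact: HtM.
have [x Yx zx] := piY z (Ht_sub_Hbar _ Hz).
exists (x, (x^-1 * z)%g); split=> //=; last by rewrite mulVKg.
have w1 : (x^-1 * z)%g = ext_in E (x^-1 * z)%g.1.
  rewrite [LHS]surjective_pairing; congr pair.
  have -> : (x^-1 * z)%g.2 = (x.2^-1 * z.2)%g by [].
  by rewrite [z.2]zx mulVg.
exists (x^-1 * z)%g.1; last by rewrite -w1.
by rewrite /HtA /= -w1; apply: HtM => //; apply/HtV/(YHt N.+3).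
Qed.
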